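(* Let $G$ be a simple graph and $\ell\geq 2$ an integer. (1) If $G$ has no isolated vertices, then $cc(G)\geq \mathrm{IC}(G;K_{\omega(G)})\geq \mathrm{C}(G;K_{\omega(G)})$. (2) $\mathrm{d}_{\ell}(G)\geq \beta_{\ell}(G)\geq \mathrm{C}(G;K_{\ell})$.
   Context: A simple graph is an undirected graph without loops and without multiple edges. A vertex is isolated if it has no neighbours. $K_n$ is the complete graph on $n$ vertices. A homomorphism $f:G\to H$ is a map $f:V(G)\to V(H)$ with $f(u)f(v)\in E(H)$ whenever $uv\in E(G)$; it is injective if it is injective on vertices (it is then also injective on edges). A subgraph of $G$ is a graph whose vertex and edge sets are subsets of $V(G)$, $E(G)$. The union $G_1\cup\cdots\cup G_k$ has vertex set $\bigcup_i V(G_i)$ and edge set $\bigcup_i E(G_i)$. A clique in $G$ is a complete subgraph of $G$; the clique number $\omega(G)$ is the maximal number of vertices of a clique in $G$, assumed finite where it occurs. The hom-complexity $\mathrm{C}(G;H)$ is the least positive integer $k$ such that there are subgraphs $G_1,\dots,G_k$ of $G$ with $G=G_1\cup\cdots\cup G_k$ and, for each $i$, a homomorphism $G_i\to H$; $\mathrm{C}(G;H)=\infty$ if no such $k$ exists. The injective hom-complexity $\mathrm{IC}(G;H)$ is defined in the same way, requiring for each $i$ an injective homomorphism $G_i\to H$. A simple graph is $\ell$-partite if its vertex set can be partitioned into $\ell$ disjoint nonempty subsets $V_1,\dots,V_\ell$ such that each edge connects vertices in two different parts. It is an $\ell$-clique (complete $\ell$-partite graph) if moreover, for some such partition, its edges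 are exactly all pairs $\{u,v\}$ with $u\in V_i$, $v\in V_j$, $i\neq j$. A family $\{G_1,\dots,G_k\}$ of subgraphs of $G$ is an edge covering of $G$ if $E(G)=\bigcup_i E(G_i)$. The clique covering number $cc(G)$, the $\ell$-particity $\beta_\ell(G)$ and the $\ell$-partite dimension $\mathrm{d}_\ell(G)$ are the least positive integer $k$ such that $G$ has an edge covering with $k$ elements $\{G_1,\dots,G_k\}$ in which each $G_i$ is, respectively, a clique, an $\ell$-partite graph, an $\ell$-clique (each is $\infty$ if no such $k$ exists). *)

(* Defs.v *)
From mathcomp Require Import all_boot all_order.
From mathcomp Require Import boolp classical_sets functions cardinality.

Set Implicit Arguments.
Unset Strict Implicit.
Unset Printing Implicit Defensive.

Local Open Scope classical_set_scope.
Local Open Scope card_scope.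

(* [None] stands for infinity. *)
Definition enat := option nat.

Definition enat_le (m n : enat) : bool :=
  match m, n with
  | _, None => true
  | None, Some _ => false
  | Some a, Some b => a <= b
  end.

Notation "m <=oo n" := (enat_le m n) (at level 70, no associativity).
Notation "m >=oo n" := (enat_le n m)
  (at level 70, no associativity, only parsing).

Definition some_elt (A : set nat) : enat :=
  if pselect (A !=set0) is left exA then Some (projT1 (cid exA)) else None.

(* [A `&` lbound A] and [A `&` ubound A] have at most one element. *)
Definition least (A : set nat) : enat := some_elt (A `&` lbound A).
Definition greatest (A : set nat) : enat := some_elt (A `&` ubound A).

(* Simple graphs, possibly infinite. *)
Record sgraph := SGraph {
  vertex :> Type;
  edge : vertex -> vertex -> Prop;
  edge_sym : forall u v, edge u v -> edge v u;
  edge_irrefl : forall u, ~ edge u u }.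

Arguments edge {s} u v.

Record subgraph (G : sgraph) := Subgraph {
  sub_vertex : set G;
  sub_edge : G -> G -> Prop;
  sub_edge_edge : forall u v, sub_edge u v -> edge u v;
  sub_edge_vertex : forall u v, sub_edge u v -> sub_vertex u;
  sub_edge_sym : forall u v, sub_edge u v -> sub_edge v u }.

Section SubgraphAsGraph.
Variables (G : sgraph) (S : subgraph G).

Let sedge (u v : sub_vertex S) : Prop := sub_edge S (val u) (val v).

Let sedge_sym u v : sedge u v -> sedge v u.
Proof. exact: sub_edge_sym. Qed.

Let sedge_irrefl u : ~ sedge u u.
Proof. by move/sub_edge_edge/edge_irrefl. Qed.

Definition sgraph_of_subgraph : sgraph := SGraph sedge_sym sedge_irrefl.

End SubgraphAsGraph.

Coercion sgraph_of_subgraph : subgraph >-> sgraph.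

Definition is_hom (G H : sgraph) (f : G -> H) : Prop :=
  forall u v : G, edge u v -> edge (f u) (f v).

Definition has_hom (G H : sgraph) : Prop := exists f : G -> H, is_hom f.

Definition has_inj_hom (G H : sgraph) : Prop :=
  exists2 f : G -> H, is_hom f & injective f.

Section CompleteGraph.
Variable n : nat.

Let cedge (u v : 'I_n) : Prop := u <> v.

Let cedge_sym u v : cedge u v -> cedge v u.
Proof. exact: nesym. Qed.

Let cedge_irrefl u : ~ cedge u u.
Proof. by apply. Qed.

Definition complete_graph : sgraph := SGraph cedge_sym cedge_irrefl.

End CompleteGraph.

Notation "''K_' n" := (complete_graph n)
  (at level 8, n at level 2, format "''K_' n").

Definition isolated (G : sgraph) (u : G) : Prop := forall v : G, ~ edge u v.

Definition is_complete (G : sgraph) : Prop :=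
  forall u v : G, u <> v -> edge u v.

Definition nb_vertices (G : sgraph) (n : nat) : Prop := [set: G] #= `I_n.

(* The empty subgraph is a clique, so the set below is never empty and
   [None] means exactly that the cliques of [G] are unbounded in size. *)
Definition clique_number (G : sgraph) : enat :=
  greatest [set n | exists2 S : subgraph G, is_complete S & nb_vertices S n].

Definition is_union (G : sgraph) (k : nat) (S : 'I_k -> subgraph G) : Prop :=
  (forall u : G, exists i, sub_vertex (S i) u) /\
  (forall u v : G, edge u v <-> exists i, sub_edge (S i) u v).

Definition is_edge_covering (G : sgraph) (k : nat) (S : 'I_k -> subgraph G) :
    Prop :=
  forall u v : G, edge u v <-> exists i, sub_edge (S i) u v.

Definition hom_complexity (G H : sgraph) : enat :=
  least [set k | 0 < k /\ exists2 S : 'I_k -> subgraph G,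
                            is_union S & forall i, has_hom (S i) H].

Definition inj_hom_complexity (G H : sgraph) : enat :=
  least [set k | 0 < k /\ exists2 S : 'I_k -> subgraph G,
                            is_union S & forall i, has_inj_hom (S i) H].

Definition is_partite (l : nat) (G : sgraph) : Prop :=
  exists2 V : 'I_l -> set G, partition [set: 'I_l] V [set: G] &
    forall u v : G, edge u v -> exists i j, [/\ i <> j, V i u & V j v].

(* Complete l-partite graph, called an l-clique. *)
Definition is_lclique (l : nat) (G : sgraph) : Prop :=
  exists2 V : 'I_l -> set G, partition [set: 'I_l] V [set: G] &
    forall u v : G, edge u v <-> exists i j, [/\ i <> j, V i u & V j v].

Definition covering_number (P : sgraph -> Prop) (G : sgraph) : enat :=
  least [set k | 0 < k /\ exists2 S : 'I_k -> subgraph G,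
                            is_edge_covering S & forall i, P (S i)].

Definition clique_covering_number : sgraph -> enat :=
  covering_number is_complete.
Definition particity (l : nat) : sgraph -> enat :=
  covering_number (is_partite l).
Definition partite_dimension (l : nat) : sgraph -> enat :=
  covering_number (is_lclique l).

(* Main.v *)
Require Import Defs.
From mathcomp Require Import all_boot all_order.
From mathcomp Require Import boolp classical_sets functions cardinality.

(** Each invariant is the least element of a set of sizes of coverings, so it
    suffices to turn coverings into coverings of the same size. A clique of [G]
    has at most [omega(G)] vertices, hence embeds into the complete graph, and a
    covering of the edges covers the vertices when none is isolated. An
    [l]-partition of a graph is a colouring by [l] colours; isolated vertices
    missed by an edge covering are added to every part with an arbitrary
    colour. *)

Local Open Scope classical_set_scope.
Local Open Scope card_scope.

Lemma some_eltP (A : set nat) (n : nat) : some_elt A = Some n -> A n.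
Proof.
by rewrite /some_elt; case: pselect => // exA [<-]; exact: projT2 (cid exA).
Qed.

Lemma some_elt_ex (A : set nat) : A !=set0 -> exists n, some_elt A = Some n.
Proof. by rewrite /some_elt; case: pselect => // exA _; eexists. Qed.

(** By well-ordering, a nonempty set of naturals has a minimum, so the choice inside [least]
    succeeds. *)
Lemma least_ex (A : set nat) (m : nat) :
  A m -> exists2 n, least A = Some n & n <= m.
Proof.
move=> Am; have exA : exists n, `[< A n >] by exists m; exact/asboolP.
case: (ex_minnP exA) => p /asboolP Ap minp.
have [|n en] := @some_elt_ex (A `&` lbound A).
  by exists p; split=> // k Ak; apply/minp/asboolP.
by exists n => //; have [_] := some_eltP _ _ en; exact.
Qed.

Lemma least_subset (A B : set nat) : B `<=` A -> least A <=oo least B.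
Proof.
move=> sBA; case eB: (least B) => [b|]; last by case: (least A).
by have [/sBA/least_ex[a ->]] := some_eltP _ _ eB.
Qed.

Section CliqueOn.
Variables (G : sgraph) (S : subgraph G) (C : set G).
Hypotheses (sCS : C `<=` sub_vertex S) (complS : is_complete S).

Let cedge (u v : G) : Prop := [/\ C u, C v & u <> v].

Let cedge_edge u v : cedge u v -> edge u v.
Proof.
case=> Cu Cv uv; apply: (@sub_edge_edge _ S).
apply: (complS (SigSub (mem_set (sCS _ Cu))) (SigSub (mem_set (sCS _ Cv)))).
by move/(congr1 val).
Qed.

Let cedge_vertex u v : cedge u v -> C u.
Proof. by case. Qed.

Let cedge_sym u v : cedge u v -> cedge v u.
Proof. by case=> Cu Cv /nesym. Qed.

(** Serves to extract finite cliques of prescribed size from an infinite one. *)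
Definition subclique : subgraph G := Subgraph cedge_edge cedge_vertex cedge_sym.

Lemma subclique_complete : is_complete subclique.
Proof.
by move=> u v uv; split; [exact: set_valP|exact: set_valP|move/val_inj].
Qed.

End CliqueOn.

(** A finite clique is bounded by maximality of [w]; an infinite one would contain a clique on
    [w.+1] vertices. *)
Lemma clique_card_le (G : sgraph) (S : subgraph G) (w : nat) :
  clique_number G = Some w -> is_complete S -> sub_vertex S #<= `I_w.
Proof.
move=> /some_eltP[_ ubw] complS.
have [[n Sn]|infS] := pselect (finite_set (sub_vertex S)).
  rewrite (card_le_eql Sn) card_le_II; apply: ubw; exists S => //.
  by rewrite /nb_vertices (card_eql (card_setT _)).
suff: w.+1 <= w by rewrite ltnn.
have /card_subP[C Cw sCS] : `I_w.+1 #<= sub_vertex S.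
  apply: card_le_trans ((infiniteP _).1 infS); exact: subset_card_le.
apply: ubw; exists (subclique _ _ _ sCS complS).
  exact: subclique_complete.
by rewrite /nb_vertices (card_eql (card_setT _)).
Qed.

Lemma clique_inj_hom (G : sgraph) (S : subgraph G) (w : nat) :
  clique_number G = Some w -> is_complete S -> has_inj_hom S 'K_w.
Proof.
move=> Gw /(clique_card_le _ _ _ Gw).
rewrite (card_le_eqr card_II) => /card_leP[f].
have injf : injective (fun u : S => val (f u)).
  by move=> u v /val_inj; apply: inj; rewrite inE.
(* Adjacency in ['K_w] is distinctness, so injectivity and the absence of loops give a
   homomorphism. *)
exists (fun u : S => val (f u)) => // u v + /= /injf uv.
by rewrite uv; exact: edge_irrefl.
Qed.

Lemma covering_union (G : sgraph) (k : nat) (S : 'I_k -> subgraph G) :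
  (forall u : G, ~ isolated u) -> is_edge_covering S -> is_union S.
Proof.
move=> nisoG covS; split=> // u.
have /existsNP[v /contrapT /covS[i uv]] := nisoG u.
by exists i; exact: sub_edge_vertex uv.
Qed.

Section Spanning.
Variables (G : sgraph) (S : subgraph G).

Definition spanning_subgraph : subgraph G :=
  @Subgraph G setT (@sub_edge G S) (@sub_edge_edge G S) (fun _ _ _ => I)
    (@sub_edge_sym G S).

(** The added vertices have no edges, so sending them all to [h0] breaks no adjacency. *)
Lemma spanning_has_hom (H : sgraph) (h0 : H) :
  has_hom S H -> has_hom spanning_subgraph H.
Proof.
case=> f homf.
pose g (u : G) : H := if insub u is Some x then f x else h0.
have gE u (Su : u \in sub_vertex S) : g u = f (SigSub Su).
  by rewrite /g insubT.
exists (fun u => g (val u)) => u v uv.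
have Su := mem_set (@sub_edge_vertex _ S _ _ uv).
have Sv := mem_set (@sub_edge_vertex _ S _ _ (@sub_edge_sym _ S _ _ uv)).
by rewrite (gE _ Su) (gE _ Sv); exact: homf.
Qed.

End Spanning.

Lemma partite_has_hom (l : nat) (G : sgraph) :
  is_partite l G -> has_hom G 'K_l.
Proof.
case=> V [covV tV _] edgeV.
have /choice[c Vc] : forall u : G, exists i, V i u.
  by move=> u; have : [set: G] u by []; rewrite -covV => -[i _]; exists i.
exists c => u v /edgeV[i [j [ij Viu Vjv]]] /= cuv.
(* Disjointness of the parts makes the chosen colour the only possible one. *)
have VP k x : V k x -> c x = k.
  by move=> Vkx; apply: tV => //; exists x; split.
by apply: ij; rewrite -(VP _ _ Viu) -(VP _ _ Vjv).
Qed.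

Lemma lclique_partite (l : nat) (G : sgraph) : is_lclique l G -> is_partite l G.
Proof. by case=> V partV edgeV; exists V => // u v /edgeV. Qed.

Theorem proposition4p5 (G : sgraph) (l : nat) (hl : 2 <= l) :
  ((forall u : G, ~ isolated u) ->
   forall w : nat, clique_number G = Some w ->
     (clique_covering_number G >=oo inj_hom_complexity G 'K_w) /\
     (inj_hom_complexity G 'K_w >=oo hom_complexity G 'K_w)) /\
  ((partite_dimension l G >=oo particity l G) /\
   (particity l G >=oo hom_complexity G 'K_l)).
Proof.
split=> [nisoG w Gw|]; split; apply: least_subset => k [k_gt0 [S covS homS]];
  split=> //.
- exists S; first exact: covering_union.
  by move=> i; exact: clique_inj_hom.
- by exists S => // i; have [f] := homS i; exists f.
- by exists S => // i; exact: lclique_partite.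
- exists (fun i => spanning_subgraph _ (S i)).
    (* Each enlarged part contains every vertex, so any index will do; one exists as [k] is
       positive. *)
    by split=> // u; exists (Ordinal k_gt0).
  (* Colour 0 is the default for the added vertices. *)
  have l_gt0 : 0 < l by exact: ltnW.
  move=> i; apply: spanning_has_hom (Ordinal l_gt0 : 'K_l) _.
  exact: partite_has_hom.
Qed.
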